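(* Let $V$ be a finite-dimensional vector space over $k$. Then $$P(V) = \bigl(T(V\otimes_c V^* )\bigr)^\circ ,$$ that is, the bialgebra $P(V)$ is canonically isomorphic, as a bialgebra, to the finite dual of the tensor bialgebra on the coalgebra $V\otimes_c V^*$.
   Context: $k$ is $\mathbb{R}$ or $\mathbb{C}$; algebras are associative unital, coalgebras coassociative counital. A linear map $\sigma:C\to \mathrm{Hom}_k(A,B)$ from a coalgebra $C$, with $A,B$ algebras, is a measuring map if $\sigma(c)(aa')=\sum_{(c)}\sigma(c_{(1)})(a)\,\sigma(c_{(2)})(a')$ and $\sigma(c)(1_A)=\epsilon(c)1_B$. The universal measuring coalgebra $\pi:P(A,B)\to \mathrm{Hom}(A,B)$ is the measuring coalgebra such that every measuring map $\sigma:C\to\mathrm{Hom}(A,B)$ factors as $\sigma=\pi\circ\rho$ for a unique coalgebra map $\rho:C\to P(A,B)$. $P(A,A)$ is a bialgebra with multiplication induced by composition in $\mathrm{End}(A)$. $TV$ is the tensor algebra of $V$. $P(V)$ is the largest subcoalgebra of $P(TV,TV)$ all of whose elements $p$ satisfy $\pi(p)(V)\subset V$; it is a sub-bialgebra of $P(TV,TV)$. $V\otimes_c V^*$ denotes $V\otimes V^*$ regarded as a coalgebra, namely the coalgebra dual to the algebra $\mathrm{End}(V)$: using the trace form to identify $V\otimes V^*=\mathrm{End}(V)$ with its dual, the comultiplication is such that $\mathrm{Hom}(V\otimes_c V^*,k)$ with the convolution product is isomorphic as an algebra to $\mathrm{End}(V)$ with composition. For a coalgebra $D$, the comultiplication and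 counit of $D$ extend uniquely to algebra homomorphisms making the tensor algebra $TD$ a bialgebra. For a bialgebra $A$, $A^\circ=P(A,k)$ is the finite dual, a bialgebra with the convolution product. *)

(* Defs.v *)
From HB Require Import structures.
From mathcomp Require Import all_boot all_order all_algebra.
From mathcomp Require Import boolp reals complex.

Set Implicit Arguments.
Unset Strict Implicit.
Unset Printing Implicit Defensive.

Import GRing.Theory.
Local Open Scope ring_scope.
Local Open Scope quotient_scope.

Variant real_or_complex (R : realType) : fieldType -> Prop :=
| scalars_real : real_or_complex R R
| scalars_complex : real_or_complex R R[i].

Notation bilin f := (bilinear_for *:%R *:%R f).

(* A tensor is a class of formal sums [\sum_i u_i (x) w_i], represented by
   lists of pairs. Two formal sums are identified when no bilinear map
   separates them, which is the universal property (see [tlift_tens] and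
   [tens_ext]). *)

Section TensorProduct.
Variables (k : fieldType) (U W : lmodType k).
Implicit Types (s t : seq (U * W)) (X : lmodType k).

Definition tsum (X : lmodType k) (b : U -> W -> X) (s : seq (U * W)) : X :=
  \sum_(p <- s) b p.1 p.2.

Definition tequiv : rel (seq (U * W)) := fun s t =>
  `[< forall (X : lmodType k) (b : U -> W -> X),
        bilin b -> tsum b s = tsum b t >].

Lemma tequiv_refl : reflexive tequiv.
Proof. by move=> s; apply/asboolP. Qed.

Lemma tequiv_sym : symmetric tequiv.
Proof.
suff H s t : tequiv s t -> tequiv t s by move=> s t; apply/idP/idP; apply: H.
by move=> /asboolP st; apply/asboolP => X b bb; rewrite st.
Qed.

Lemma tequiv_trans : transitive tequiv.
Proof.
move=> t s u /asboolP st /asboolP tu; apply/asboolP => X b bb.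
by rewrite st ?tu.
Qed.

Canonical tequiv_equiv := EquivRel tequiv tequiv_refl tequiv_sym tequiv_trans.

Definition tensor := {eq_quot tequiv}.

HB.instance Definition _ := Choice.on tensor.
HB.instance Definition _ := EqQuotient.on tensor.

(* Meaningful when [b] is bilinear: it is then the linear map
   [u (x) w |-> b u w]. *)
Definition tlift (X : lmodType k) (b : U -> W -> X) (t : tensor) : X :=
  tsum b (repr t).

Definition tens (u : U) (w : W) : tensor := \pi_tensor [:: (u, w)].

Lemma tlift_pi X (b : U -> W -> X) s :
  bilin b -> tlift b (\pi_tensor s) = tsum b s.
Proof.
move=> bb; rewrite /tlift.
have /eqmodP/asboolP -> // : repr (\pi_tensor s) = s %[mod tensor].
by rewrite reprK.
Qed.

Lemma tensorP (x y : tensor) :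
  (forall X (b : U -> W -> X), bilin b -> tlift b x = tlift b y) -> x = y.
Proof.
move=> xy; rewrite -[x]reprK -[y]reprK; apply/eqmodP/asboolP => X b bb.
exact: xy.
Qed.

Definition tadd (x y : tensor) : tensor := \pi_tensor (repr x ++ repr y).
Definition tscale (a : k) (x : tensor) : tensor :=
  \pi_tensor [seq (a *: p.1, p.2) | p <- repr x].
Definition tzero : tensor := \pi_tensor [::].
Definition topp (x : tensor) : tensor := tscale (- 1) x.

Let tliftD' X (b : U -> W -> X) x y :
  bilin b -> tlift b (tadd x y) = tlift b x + tlift b y.
Proof. by move=> bb; rewrite tlift_pi // /tsum big_cat. Qed.

Let bilinZl X (b : U -> W -> X) a u w :
  bilin b -> b (a *: u) w = a *: b u w.
Proof.
by move=> bb; have /= := scalable_linear (bb.1 w); apply.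
Qed.

Let tliftZ' X (b : U -> W -> X) a x :
  bilin b -> tlift b (tscale a x) = a *: tlift b x.
Proof.
move=> bb; rewrite tlift_pi // /tlift /tsum big_map scaler_sumr.
by apply: eq_bigr => p _ /=; rewrite bilinZl.
Qed.

Let tlift0' X (b : U -> W -> X) : bilin b -> tlift b tzero = 0.
Proof. by move=> bb; rewrite tlift_pi // /tsum big_nil. Qed.

Fact taddA : associative tadd.
Proof. by move=> x y z; apply: tensorP => X b bb; rewrite !tliftD' // addrA. Qed.
Fact taddC : commutative tadd.
Proof. by move=> x y; apply: tensorP => X b bb; rewrite !tliftD' // addrC. Qed.
Fact tadd0 : left_id tzero tadd.
Proof.
by move=> x; apply: tensorP => X b bb; rewrite tliftD' // tlift0' // add0r.
Qed.
Fact taddN : left_inverse tzero topp tadd.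
Proof.
move=> x; apply: tensorP => X b bb.
by rewrite tliftD' // tlift0' // tliftZ' // scaleN1r addNr.
Qed.

HB.instance Definition _ := GRing.isZmodule.Build tensor taddA taddC tadd0 taddN.

Fact tscaleA a b x : tscale a (tscale b x) = tscale (a * b) x.
Proof.
by apply: tensorP => X c bc; rewrite !tliftZ' // scalerA.
Qed.
Fact tscale1 : left_id 1 tscale.
Proof. by move=> x; apply: tensorP => X b bb; rewrite tliftZ' // scale1r. Qed.
Fact tscaleDr : right_distributive tscale +%R.
Proof.
move=> a x y; apply: tensorP => X b bb.
by rewrite [RHS]tliftD' // !tliftZ' // [in LHS]tliftD' // scalerDr.
Qed.
Fact tscaleDl x : {morph tscale^~ x : a b / a + b}.
Proof.
move=> a b; apply: tensorP => X c bc.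
by rewrite [RHS]tliftD' // !tliftZ' // scalerDl.
Qed.

HB.instance Definition _ :=
  GRing.Zmodule_isLmodule.Build k tensor tscaleA tscale1 tscaleDr tscaleDl.

Lemma tlift_tens X (b : U -> W -> X) u w :
  bilin b -> tlift b (tens u w) = b u w.
Proof. by move=> bb; rewrite tlift_pi // /tsum big_seq1. Qed.

Lemma tlift_linear X (b : U -> W -> X) : bilin b -> linear (tlift b).
Proof.
by move=> bb a x y; rewrite [LHS]tliftD' // [tlift b (a *: x)]tliftZ'.
Qed.

Lemma tlift_sum X (b : U -> W -> X) (I : Type) (r : seq I) (P : pred I)
    (F : I -> tensor) : bilin b ->
  tlift b (\sum_(i <- r | P i) F i) = \sum_(i <- r | P i) tlift b (F i).
Proof.
move=> bb; pose f := HB.pack_for {linear tensor -> X} (tlift b)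
  (GRing.isLinear.Build k tensor X *:%R (tlift b) (tlift_linear bb)).
exact: (linear_sum f).
Qed.

Lemma tlift_combine X (b b' : U -> W -> X) a (t : tensor) :
  tlift (fun u w => a *: b u w + b' u w) t = a *: tlift b t + tlift b' t.
Proof. by rewrite /tlift /tsum big_split /= scaler_sumr. Qed.

Lemma tens_bilin : bilin tens.
Proof.
split=> [w a u u'|u a w w']; apply: tensorP => X b bb;
  rewrite tlift_linear // !tlift_tens //.
- exact: bb.1.
- exact: bb.2.
Qed.

Lemma tensor_sum (t : tensor) : exists s, t = \sum_(p <- s) tens p.1 p.2.
Proof.
exists (repr t); apply: tensorP => X b bb.
by rewrite tlift_sum //; apply: eq_bigr => p _; rewrite tlift_tens.
Qed.

Lemma tens_ext X (f g : tensor -> X) : linear f -> linear g ->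
  (forall u w, f (tens u w) = g (tens u w)) -> f =1 g.
Proof.
move=> lf lg fg t; have [s ->] := tensor_sum t.
pose F := HB.pack_for {linear tensor -> X} f
  (GRing.isLinear.Build k tensor X *:%R f lf).
pose G := HB.pack_for {linear tensor -> X} g
  (GRing.isLinear.Build k tensor X *:%R g lg).
rewrite -[LHS]/(F _) -[RHS]/(G _) !linear_sum.
by apply: eq_bigr => p _; apply: fg.
Qed.

End TensorProduct.

(* [tlift b (comul c)] is the Sweedler sum [\sum_(c) b c_(1) c_(2)]. *)

HB.mixin Record isCoalgebra (k : fieldType) C of GRing.Lmodule k C := {
  comul : C -> tensor C C;
  counit : C -> k^o;
  comul_linear : linear comul;
  counit_linear : linear counit;
  comulA : forall c : C,
    tlift (fun x z => tlift (fun x1 x2 => tens (tens x1 x2) z) (comul x))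
      (comul c)
    = tlift (fun x y => tlift (fun y1 y2 => tens (tens x y1) y2) (comul y))
        (comul c);
  counitl : forall c : C, tlift (fun x y => (counit x : k) *: y) (comul c) = c;
  counitr : forall c : C, tlift (fun x y => (counit y : k) *: x) (comul c) = c
}.

#[short(type="coalgType")]
HB.structure Definition Coalgebra (k : fieldType) :=
  {C of GRing.Lmodule k C & isCoalgebra k C}.

Notation sweedler b c := (tlift b (comul c)).

HB.mixin Record Coalgebra_isBialgebra (k : fieldType) B
    of Coalgebra k B & GRing.Algebra k B := {
  comul1 : comul (1 : B) = tens 1 1;
  comulM : forall x y : B, comul (x * y) =
    sweedler (fun x1 x2 =>
      sweedler (fun y1 y2 => tens (x1 * y1) (x2 * y2)) y) x;
  counit1 : counit (1 : B) = 1;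
  counitM : forall x y : B, counit (x * y) = (counit x : k) * counit y
}.

#[short(type="bialgType")]
HB.structure Definition Bialgebra (k : fieldType) :=
  {B of Coalgebra k B & GRing.Algebra k B & Coalgebra_isBialgebra k B}.

Section Morphisms.
Variable k : fieldType.

Definition alg_morphism (A B : algType k) (f : A -> B) : Prop :=
  linear f /\ monoid_morphism f.

Definition coalg_morphism (C D : coalgType k) (f : C -> D) : Prop :=
  [/\ linear f,
      forall c, counit (f c) = counit c :> k
    & forall c, comul (f c) = sweedler (fun x y => tens (f x) (f y)) c].

Definition bialg_morphism (B H : bialgType k) (f : B -> H) : Prop :=
  alg_morphism f /\ coalg_morphism f.

Definition bialg_isomorphism (B H : bialgType k) (f : B -> H) : Prop :=
  bialg_morphism f /\
  exists g : H -> B, [/\ bialg_morphism g, cancel f g & cancel g f].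

(* [algType] excludes the zero algebra, which would add nothing here: every
   space has exactly one linear map to it. *)
Definition is_tensor_algebra (V : lmodType k) (T : algType k) (i : V -> T) :
    Prop :=
  linear i /\
  forall (A : algType k) (f : V -> A), linear f ->
    exists! g : T -> A, alg_morphism g /\ (forall v, g (i v) = f v).

(* On a tensor algebra, comultiplication and counit are algebra morphisms, so
   they are determined by their values on [D]. *)
Definition is_tensor_bialgebra (D : coalgType k) (T : bialgType k)
    (i : D -> T) : Prop :=
  is_tensor_algebra i /\ coalg_morphism i.

(* A linear map [C -> Hom(A, B)] is given in curried form [C -> A -> B]. *)

Definition measuring (C : coalgType k) (A B : algType k)
    (sigma : C -> A -> B) : Prop :=
  [/\ bilin sigma,
      forall c a a', sigma c (a * a') =
        sweedler (fun c1 c2 => sigma c1 a * sigma c2 a') c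
    & forall c, sigma c 1 = (counit c : k) *: 1].

Definition universal_measuring (A B : algType k) (P : coalgType k)
    (pi : P -> A -> B) : Prop :=
  measuring pi /\
  forall (C : coalgType k) (sigma : C -> A -> B), measuring sigma ->
    exists! rho : C -> P,
      coalg_morphism rho /\ (forall c a, sigma c a = pi (rho c) a).

(* [P(A, A)] as a bialgebra. *)
Definition is_measuring_bialgebra (A : algType k) (P : bialgType k)
    (pi : P -> A -> A) : Prop :=
  [/\ universal_measuring pi,
      forall p q a, pi (p * q) a = pi p (pi q a)
    & forall a, pi 1 a = a].

(* [P(A, k)] as a bialgebra, for a bialgebra [A]; its product is convolution,
   whose unit is the counit of [A]. *)
Definition is_finite_dual (A Q : bialgType k) (pi : Q -> A -> k^o) : Prop :=
  [/\ universal_measuring pi,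
      forall p q a, pi (p * q) a =
        sweedler (fun a1 a2 => pi p a1 * pi q a2) a
    & forall a, pi 1 a = counit a].

Definition subcoalgebra (C : coalgType k) (S : {pred C}) : Prop :=
  GRing.submod_closed S /\
  forall c, c \in S -> exists s : seq (C * C),
    (forall p, p \in s -> p.1 \in S /\ p.2 \in S)
    /\ comul c = \sum_(p <- s) tens p.1 p.2.

Definition preserves_gens (V : lmodType k) (T : algType k) (i : V -> T)
    (P : coalgType k) (pi : P -> T -> T) (S : {pred P}) : Prop :=
  forall p, p \in S -> forall v, exists w, pi p (i v) = i w.

(* [P(V)] is given as a bialgebra [B] together with an injective bialgebra
   morphism [j] to [P(TV, TV)] whose image is the largest subcoalgebra
   preserving [V]. *)
Definition is_PV (V : lmodType k) (T : algType k) (i : V -> T)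
    (P : bialgType k) (pi : P -> T -> T) (B : bialgType k) (j : B -> P) :
    Prop :=
  [/\ bialg_morphism j, injective j
    & exists S : {pred P},
      [/\ forall p, p \in S <-> exists b, j b = p,
          subcoalgebra S, preserves_gens i pi S
        & forall S' : {pred P}, subcoalgebra S' -> preserves_gens i pi S' ->
            {subset S' <= S}]].

End Morphisms.

(* [coEnd V] is the coalgebra [V (x)_c V^*]. Under the trace form,
   [v (x) f] is the functional [F |-> f (F v)] on [End(V)]. For a basis [e] with dual basis [e^*],
     f ((F \o G) v) = \sum_i f (F e_i) * e^*_i (G v),
   so the comultiplication dual to composition maps [v (x) f] to
   [\sum_i (e_i (x) f) (x) (v (x) e^*_i)], see [trace_pairing_comp]; the counit
   is the pairing with the identity. *)

Section CoEnd.
Variables (k : fieldType) (V : vectType k).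

Definition dualv : lmodType k := 'Hom(V, k^o).

Definition coEnd := tensor V dualv.

HB.instance Definition _ := GRing.Lmodule.on coEnd.

Definition trace_pairing (F : 'End(V)) : coEnd -> k^o :=
  tlift (fun (v : V) (f : dualv) => (f : 'Hom(V, k^o)) (F v)).

Let e (i : 'I_(\dim {:V})) : V := (vbasis {:V})`_i.
Let e' (i : 'I_(\dim {:V})) : dualv :=
  linfun (coord (vbasis {:V}) i : V -> k^o).

Definition coEnd_comul_pure (v : V) (f : dualv) : tensor coEnd coEnd :=
  \sum_(i < \dim {:V}) tens (tens (e i) f : coEnd) (tens v (e' i) : coEnd).

Definition coEnd_comul : coEnd -> tensor coEnd coEnd := tlift coEnd_comul_pure.

Definition coEnd_counit : coEnd -> k^o := trace_pairing \1%VF.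

Lemma tens_linearl (U W : lmodType k) (w : W) : linear ((@tens k U W)^~ w).
Proof. exact: (tens_bilin U W).1. Qed.

Lemma tens_linearr (U W : lmodType k) (u : U) : linear (@tens k U W u).
Proof. exact: (tens_bilin U W).2. Qed.

Lemma tens_suml (U W : lmodType k) (I : Type) (r : seq I) (F : I -> U) (w : W) :
  tens (\sum_(i <- r) F i) w = \sum_(i <- r) tens (F i) w.
Proof.
pose f := HB.pack_for {linear U -> tensor U W} ((@tens k U W)^~ w)
  (GRing.isLinear.Build k U _ *:%R _ (@tens_linearl U W w)).
exact: (linear_sum f).
Qed.

Lemma tens_sumr (U W : lmodType k) (I : Type) (r : seq I) (u : U) (F : I -> W) :
  tens u (\sum_(i <- r) F i) = \sum_(i <- r) tens u (F i).
Proof.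
pose f := HB.pack_for {linear W -> tensor U W} (@tens k U W u)
  (GRing.isLinear.Build k W _ *:%R _ (@tens_linearr U W u)).
exact: (linear_sum f).
Qed.

Lemma tensZl (U W : lmodType k) a (u : U) (w : W) :
  tens (a *: u) w = a *: tens u w.
Proof. exact: (scalable_linear (@tens_linearl U W w)). Qed.

Lemma tensZr (U W : lmodType k) a (u : U) (w : W) :
  tens u (a *: w) = a *: tens u w.
Proof. exact: (scalable_linear (@tens_linearr U W u)). Qed.

Lemma coEnd_comul_pure_bilin : bilin coEnd_comul_pure.
Proof.
split=> [f a v v'|v a f f']; rewrite /coEnd_comul_pure /= scaler_sumr -big_split.
- by apply: eq_bigr => i _ /=; rewrite tens_linearl tens_linearr.
- by apply: eq_bigr => i _ /=; rewrite tens_linearr tens_linearl.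
Qed.

Lemma coEnd_comul_linear : linear coEnd_comul.
Proof. exact: tlift_linear coEnd_comul_pure_bilin. Qed.

Lemma coEnd_comul_tens v f :
  coEnd_comul (tens v f) = coEnd_comul_pure v f.
Proof. exact: tlift_tens coEnd_comul_pure_bilin. Qed.

Lemma trace_pairing_bilin (F : 'End(V)) :
  bilin (fun (v : V) (f : dualv) => (f : 'Hom(V, k^o)) (F v) : k^o).
Proof.
split=> [f a v v'|v a f f']; first by rewrite !linearP.
by rewrite add_lfunE scale_lfunE.
Qed.

Lemma trace_pairing_linear F : linear (trace_pairing F).
Proof. exact: tlift_linear (trace_pairing_bilin F). Qed.

Lemma trace_pairing_tens F v (f : dualv) :
  trace_pairing F (tens v f) = (f : 'Hom(V, k^o)) (F v).
Proof. exact: (tlift_tens _ _ (trace_pairing_bilin F)). Qed.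

Lemma coEnd_counit_linear : linear coEnd_counit.
Proof. exact: trace_pairing_linear. Qed.

Lemma dual_basisl (v : V) : \sum_i (e' i : 'Hom(V, k^o)) v *: e i = v.
Proof.
rewrite [RHS](coord_vbasis (memvf v)).
by apply: eq_bigr => i _; rewrite lfunE.
Qed.

Lemma dual_basisr (f : dualv) : \sum_i ((f : 'Hom(V, k^o)) (e i) : k) *: e' i = f.
Proof.
apply/(@lfunP _ V k^o) => v; rewrite sum_lfunE -[in RHS](dual_basisl v) linear_sum.
by apply: eq_bigr => i _; rewrite scale_lfunE linearZ; exact: mulrC.
Qed.

Lemma coEnd_comulA_bilinl (g : coEnd -> tensor coEnd coEnd) : linear g ->
  bilin (fun x z : coEnd =>
    tlift (fun x1 x2 => tens (tens x1 x2 : tensor coEnd coEnd) z) (g x)).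
Proof.
move=> lg; have bz (z : coEnd) : bilin (fun x1 x2 : coEnd => tens (tens x1 x2) z).
  by split=> [u a x x'|u a x x'] /=; rewrite (tens_linearl, tens_linearr) tens_linearl.
split=> [z a x x'|x a z z']; first by rewrite lg tlift_linear.
by rewrite -tlift_combine; congr tlift; apply/funext=> ?; apply/funext=> ?;
  rewrite tens_linearr.
Qed.

Lemma coEnd_comulA_bilinr (g : coEnd -> tensor coEnd coEnd) : linear g ->
  bilin (fun x y : coEnd =>
    tlift (fun y1 y2 => tens (tens x y1 : tensor coEnd coEnd) y2) (g y)).
Proof.
move=> lg; have bx (x : coEnd) : bilin (fun y1 y2 : coEnd => tens (tens x y1) y2).
  by split=> [u a y y'|u a y y'] /=; rewrite tens_linearr ?tens_linearl.
split=> [y a x x'|x a y y']; last by rewrite lg tlift_linear.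
by rewrite -tlift_combine; congr tlift; apply/funext=> ?; apply/funext=> ?;
  rewrite !tens_linearl.
Qed.

Lemma coEnd_comulA (c : coEnd) :
  tlift (fun x z => tlift (fun x1 x2 => tens (tens x1 x2) z) (coEnd_comul x))
    (coEnd_comul c)
  = tlift (fun x y => tlift (fun y1 y2 => tens (tens x y1) y2) (coEnd_comul y))
      (coEnd_comul c).
Proof.
have bl := coEnd_comulA_bilinl coEnd_comul_linear.
have br := coEnd_comulA_bilinr coEnd_comul_linear.
pose f := fun c => tlift (fun x z : coEnd =>
  tlift (fun x1 x2 => tens (tens x1 x2) z) (coEnd_comul x)) (coEnd_comul c).
pose g := fun c => tlift (fun x y : coEnd =>
  tlift (fun y1 y2 => tens (tens x y1) y2) (coEnd_comul y)) (coEnd_comul c).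
rewrite -/(f c) -/(g c); move: c; apply: tens_ext => [a x y|a x y|v h].
- by rewrite /f coEnd_comul_linear tlift_linear.
- by rewrite /g coEnd_comul_linear tlift_linear.
have bz (z : coEnd) : bilin (fun x1 x2 : coEnd => tens (tens x1 x2) z).
  by split=> [u a x x'|u a x x'] /=;
    rewrite (tens_linearl, tens_linearr) tens_linearl.
have bx (x : coEnd) : bilin (fun y1 y2 : coEnd => tens (tens x y1) y2).
  by split=> [u a y y'|u a y y'] /=; rewrite tens_linearr ?tens_linearl.
rewrite /f /g !coEnd_comul_tens /coEnd_comul_pure !tlift_sum //.
under eq_bigr => i _ do
  rewrite tlift_tens // coEnd_comul_tens /coEnd_comul_pure tlift_sum //.
under [RHS]eq_bigr => i _ do
  rewrite tlift_tens // coEnd_comul_tens /coEnd_comul_pure tlift_sum //.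
rewrite exchange_big; apply: eq_bigr => i _; apply: eq_bigr => j _.
by rewrite !tlift_tens.
Qed.

Lemma coEnd_counitl (c : coEnd) :
  tlift (fun x y => (coEnd_counit x : k) *: y) (coEnd_comul c) = c.
Proof.
have b : bilin (fun x y : coEnd => (coEnd_counit x : k) *: y).
  split=> [u a x y|u a x y] /=; last by rewrite scalerDr !scalerA mulrC.
  by rewrite coEnd_counit_linear scalerDl scalerA.
pose f := fun c => tlift (fun x y : coEnd => (coEnd_counit x : k) *: y)
  (coEnd_comul c).
rewrite -/(f c) -[RHS]/(idfun c); move: c.
apply: tens_ext => [a x y|a x y|v h] //.
  by rewrite /f coEnd_comul_linear tlift_linear.
rewrite /f coEnd_comul_tens tlift_sum //= -[in RHS](dual_basisr h) tens_sumr.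
apply: eq_bigr => i _.
by rewrite tlift_tens // /coEnd_counit trace_pairing_tens id_lfunE tensZr.
Qed.

Lemma coEnd_counitr (c : coEnd) :
  tlift (fun x y => (coEnd_counit y : k) *: x) (coEnd_comul c) = c.
Proof.
have b : bilin (fun x y : coEnd => (coEnd_counit y : k) *: x).
  split=> [u a x y|u a x y] /=; first by rewrite scalerDr !scalerA mulrC.
  by rewrite coEnd_counit_linear scalerDl scalerA.
pose f := fun c => tlift (fun x y : coEnd => (coEnd_counit y : k) *: x)
  (coEnd_comul c).
rewrite -/(f c) -[RHS]/(idfun c); move: c.
apply: tens_ext => [a x y|a x y|v h] //.
  by rewrite /f coEnd_comul_linear tlift_linear.
rewrite /f coEnd_comul_tens tlift_sum //= -[in RHS](dual_basisl v) tens_suml.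
apply: eq_bigr => i _.
by rewrite tlift_tens // /coEnd_counit trace_pairing_tens id_lfunE tensZl.
Qed.

HB.instance Definition _ := isCoalgebra.Build k coEnd
  coEnd_comul_linear coEnd_counit_linear coEnd_comulA coEnd_counitl
  coEnd_counitr.

(* Under [trace_pairing], composition in [End(V)] is convolution and the
   identity is the counit. *)
Lemma trace_pairing_comp (F G : 'End(V)) (d : coEnd) :
  trace_pairing (F \o G) d =
    sweedler (fun x y => trace_pairing F x * trace_pairing G y : k^o) d.
Proof.
have b : bilin (fun x y : coEnd => trace_pairing F x * trace_pairing G y : k^o).
  split=> [u a x y|u a x y] /=; rewrite trace_pairing_linear.
  - by rewrite mulrDl -mulrA.
  - by rewrite mulrDr mulrCA.
move: d; apply: tens_ext => [|a x y|v f]; first exact: trace_pairing_linear.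
  by rewrite comul_linear tlift_linear.
rewrite /comul /= coEnd_comul_tens tlift_sum // trace_pairing_tens comp_lfunE.
rewrite -[in LHS](dual_basisl (G v)) !linear_sum.
apply: eq_bigr => i _; rewrite tlift_tens // !trace_pairing_tens !linearZ.
exact: mulrC.
Qed.

Lemma trace_pairing_id (d : coEnd) : trace_pairing \1%VF d = counit d.
Proof. by []. Qed.

Lemma trace_pairing_inj (F G : 'End(V)) :
  trace_pairing F =1 trace_pairing G -> F = G.
Proof.
move=> FG; apply/lfunP => v; rewrite -[F v]dual_basisl -[G v]dual_basisl.
by apply: eq_bigr => i _; rewrite -!trace_pairing_tens FG.
Qed.

Lemma trace_pairing_surj (h : coEnd -> k^o) :
  linear h -> exists F : 'End(V), trace_pairing F =1 h.
Proof.
move=> lh; pose H := HB.pack_for {linear coEnd -> k^o} h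
  (GRing.isLinear.Build k coEnd k^o *:%R h lh).
pose F v := \sum_i (h (tens v (e' i)) : k) *: e i.
have lF : linear F.
  move=> a u v; rewrite /F scaler_sumr -big_split; apply: eq_bigr => i _ /=.
  by rewrite tens_linearl lh scalerDl scalerA.
pose F' := HB.pack_for {linear V -> V} F (GRing.isLinear.Build k V V *:%R F lF).
exists (linfun F'); apply: tens_ext => // [|v f]; first exact: trace_pairing_linear.
rewrite trace_pairing_tens lfunE /= /F linear_sum -[in RHS](dual_basisr f).
rewrite tens_sumr -[RHS]/(H _) linear_sum.
by apply: eq_bigr => i _; rewrite tensZr !linearZ; apply: mulrC.
Qed.

End CoEnd.

(* Main.v *)
(* Both bialgebras represent the same functor. As [TV] and [TD] are free, a
   measuring map out of either is given by its values on generators: it is an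
   algebra morphism to a convolution algebra. Hence coalgebra maps
   [C -> P(V)] and coalgebra maps [C -> (TD)^o] both correspond to linear maps
   [C -> End(V)], by the trace pairing for the latter. Multiplicativity of the
   resulting isomorphism follows by comparing two coalgebra maps
   [P(V) (x) P(V) -> (TD)^o] on generators, where the product of [End(V)] is
   convolution. That coalgebra maps to [P(TV, TV)] with image in [P(V)] are
   coalgebra maps to [P(V)] uses a linear retraction of the inclusion. *)

Require Import Defs.
From HB Require Import structures.
From mathcomp Require Import all_boot all_order all_algebra.
From mathcomp Require Import boolp reals complex.
From mathcomp Require classical_sets.
Local Open Scope ring_scope.

Set Implicit Arguments.
Unset Strict Implicit.
Unset Printing Implicit Defensive.

Import GRing.Theory.

(** * Linear and bilinear maps, with a tactic for linearity *)

Section Linear.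
Variable k : fieldType.
Implicit Types U W X Y : lmodType k.

Lemma lin_sum U W (f : U -> W) (I : Type) (r : seq I) (F : I -> U) :
  linear f -> f (\sum_(i <- r) F i) = \sum_(i <- r) f (F i).
Proof.
move=> lf; exact: (linear_sum (HB.pack_for {linear U -> W} f
  (GRing.isLinear.Build k U W *:%R f lf))).
Qed.

Lemma linD U W (f : U -> W) : linear f -> {morph f : x y / x + y}.
Proof. by move=> lf x y; rewrite -[x in LHS]scale1r lf scale1r. Qed.

Lemma lin0 U W (f : U -> W) : linear f -> f 0 = 0.
Proof. by move=> lf; apply: (@addrI _ (f 0)); rewrite -linD // !addr0. Qed.

Lemma linZ U W (f : U -> W) a u : linear f -> f (a *: u) = a *: f u.
Proof. by move=> lf; rewrite -[a *: u]addr0 lf lin0 // addr0. Qed.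

Lemma lin_id U : linear (fun x : U => x).
Proof. by []. Qed.

(** Lets [lin] present a bare function as an abstraction, the form that its patterns expect. *)
Lemma lin_eta U W (f : U -> W) : linear (fun x => f x) -> linear f.
Proof. by []. Qed.

Lemma lin_comp U W X (f : W -> X) (g : U -> W) :
  linear f -> linear g -> linear (fun x => f (g x)).
Proof. by move=> lf lg a x y; rewrite lg lf. Qed.

Lemma lin_mull U (A : algType k) (g : U -> A) b :
  linear g -> linear (fun x => g x * b).
Proof. by move=> lg a x y; rewrite lg mulrDl scalerAl. Qed.

Lemma lin_mulr U (A : algType k) (g : U -> A) b :
  linear g -> linear (fun x => b * g x).
Proof. by move=> lg a x y; rewrite lg mulrDr scalerAr. Qed.

Lemma lin_scalel U W (g : U -> k^o) (w : W) :
  linear g -> linear (fun x => (g x : k) *: w).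
Proof. by move=> lg a x y; rewrite lg scalerDl -scalerA. Qed.

Lemma lin_scaler U W (g : U -> W) (a : k) :
  linear g -> linear (fun x => a *: g x).
Proof. by move=> lg b x y; rewrite lg scalerDr !scalerA mulrC. Qed.

(** At a fixed tensor, [tlift] sums over a fixed representative, so it depends linearly on the map
    being lifted. *)
Lemma lin_tlift U W X Y (b : X -> U -> W -> Y) t :
  (forall u w, linear (fun x => b x u w)) -> linear (fun x => tlift (b x) t).
Proof.
move=> lb a x y; rewrite -tlift_combine; congr tlift.
by apply/funext=> u; apply/funext=> w; exact: lb.
Qed.

Lemma bilinI U W X (b : U -> W -> X) :
  (forall w, linear (fun u => b u w)) -> (forall u, linear (fun w => b u w)) ->
  bilin b.
Proof. by []. Qed.

Lemma bilinl U W X (b : U -> W -> X) : bilin b -> forall w, linear (b^~ w).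
Proof. by case. Qed.

Lemma bilinr U W X (b : U -> W -> X) : bilin b -> forall u, linear (b u).
Proof. by case. Qed.
End Linear.

(* Structural recursion on a multilinear expression; composite functions are
   discharged by linearity or bilinearity hypotheses in the context. *)
Ltac lin := cbv beta;
  match goal with
  | |- bilinear_for _ _ _ => refine (bilinI _ _); lin
  | |- forall _, _ => intro; lin
  | |- GRing.linear_for _ (fun x => x) => exact: lin_id
  | |- GRing.linear_for _ (fun x => tens (@?g x) ?w) =>
      refine (lin_comp (tens_linearl w) (g := g) _); lin
  | |- GRing.linear_for _ (fun x => tens ?u (@?g x)) =>
      refine (lin_comp (tens_linearr u) (g := g) _); lin
  | |- GRing.linear_for _ (fun x => tlift ?b (@?g x)) =>
      refine (lin_comp (tlift_linear (b := b) _) (g := g) _); lin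
  | |- GRing.linear_for _ (fun x => tlift (@?b x) ?t) =>
      refine (lin_tlift (b := b) _ _); lin
  | |- GRing.linear_for _ (fun x => comul (@?g x)) =>
      refine (lin_comp comul_linear (g := g) _); lin
  | |- GRing.linear_for _ (fun x => counit (@?g x)) =>
      refine (lin_comp counit_linear (g := g) _); lin
  | |- GRing.linear_for _ (fun x => (@?g x) * ?b) =>
      refine (lin_mull (g := g) b _); lin
  | |- GRing.linear_for _ (fun x => ?b * (@?g x)) =>
      refine (lin_mulr (g := g) b _); lin
  | |- GRing.linear_for _ (fun x => ?b *: (@?g x)) =>
      refine (lin_scaler (g := g) b _); lin
  | |- GRing.linear_for _ (fun x => (@?g x) *: ?b) =>
      refine (lin_scalel (g := g) b _); lin
  | H : bilinear_for _ _ ?f |- GRing.linear_for _ (fun x => ?f (@?g x) ?y) =>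
      refine (lin_comp (bilinl H y) (g := g) _); lin
  | H : bilinear_for _ _ ?f |- GRing.linear_for _ (fun x => ?f ?y (@?g x)) =>
      refine (lin_comp (bilinr H y) (g := g) _); lin
  | H : GRing.linear_for _ ?f |- GRing.linear_for _ (fun x => ?f (@?g x)) =>
      refine (lin_comp H (g := g) _); lin
  | H : GRing.linear_for _ ?f |- GRing.linear_for _ ?f => exact H
  | |- GRing.linear_for _ (fun x => _) => by []
  | |- _ => refine (lin_eta _); lin
  end.

(** * Computation with tensors and Sweedler sums *)

Section Tensor.
Variable k : fieldType.
Implicit Types U W X Y : lmodType k.

Lemma eq_tlift U W X (b b' : U -> W -> X) t :
  (forall u w, b u w = b' u w) -> tlift b t = tlift b' t.
Proof. by move=> bb; apply: eq_bigr => p _. Qed.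

Lemma lin_tliftE U W X Y (h : X -> Y) (b : U -> W -> X) t :
  linear h -> h (tlift b t) = tlift (fun u w => h (b u w)) t.
Proof. exact: lin_sum. Qed.

(** Both sides are one double sum, over the chosen representatives of [s] and [t]. *)
Lemma exchange_tlift U W U' W' X (b : U -> W -> U' -> W' -> X) s t :
  tlift (fun u w => tlift (b u w) t) s =
  tlift (fun u' w' => tlift (fun u w => b u w u' w') s) t.
Proof. exact: exchange_big. Qed.

Lemma tlift_tlift U W U' W' X (b : U' -> W' -> X)
    (c : U -> W -> tensor U' W') t :
  bilin b -> tlift b (tlift c t) = tlift (fun u w => tlift b (c u w)) t.
Proof. by move=> bb; apply: lin_tliftE; apply: tlift_linear. Qed.

(** Read from right to left, it turns a bare comultiplication into a Sweedler sum. *)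
Lemma tlift_eta U W (t : tensor U W) : tlift (@tens k U W) t = t.
Proof.
have b := tens_bilin U W.
suff: tlift (@tens k U W) =1 (fun t => t) by apply.
by apply: tens_ext => [||u w]; [lin|lin|rewrite tlift_tens].
Qed.

End Tensor.

Section Sweedler.
Variables (k : fieldType) (C : coalgType k).

(** This is [comulA] after applying the linear map that the trilinear [t] induces on triple
    tensors. *)
Lemma sweedlerA (X : lmodType k) (t : C -> C -> C -> X) c :
  (forall y z, linear (fun x => t x y z)) ->
  (forall x z, linear (fun y => t x y z)) ->
  (forall x y, linear (fun z => t x y z)) ->
  sweedler (fun x z => sweedler (fun x1 x2 => t x1 x2 z) x) c =
  sweedler (fun x y => sweedler (fun y1 y2 => t x y1 y2) y) c.
Proof.
move=> l1 l2 l3.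
have bt z : bilin (fun x y => t x y z) by [].
have b : bilin (fun (u : tensor C C) z => tlift (fun x y => t x y z) u) by lin.
have := congr1 (tlift (fun u z => tlift (fun x y => t x y z) u)) (comulA c).
rewrite !tlift_tlift //.
under eq_tlift => u w do rewrite tlift_tlift //.
under [X in _ = X -> _]eq_tlift => u w do rewrite tlift_tlift //.
under eq_tlift => u w do under eq_tlift => ? ? do rewrite !tlift_tens //.
by under [X in _ = X -> _]eq_tlift => u w do
  under eq_tlift => ? ? do rewrite !tlift_tens //.
Qed.

Lemma sweedler_counitl (X : lmodType k) (f : C -> X) c : linear f ->
  sweedler (fun x y => (counit x : k) *: f y) c = f c.
Proof.
move=> lf; rewrite -[in RHS](counitl c) lin_tliftE //.
by apply: eq_tlift => x y; rewrite linZ.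
Qed.

Lemma sweedler_counitr (X : lmodType k) (f : C -> X) c : linear f ->
  sweedler (fun x y => (counit y : k) *: f x) c = f c.
Proof.
move=> lf; rewrite -[in RHS](counitr c) lin_tliftE //.
by apply: eq_tlift => x y; rewrite linZ.
Qed.
End Sweedler.

(** * Coalgebra morphisms *)

Section CoalgMorphism.
Variable k : fieldType.

Lemma sweedler_morph (C D : coalgType k) (f : C -> D) (X : lmodType k)
    (b : D -> D -> X) c : coalg_morphism f -> bilin b ->
  sweedler b (f c) = sweedler (fun x y => b (f x) (f y)) c.
Proof.
case=> lf _ cf bb; rewrite cf tlift_tlift //.
by apply: eq_tlift => x y; rewrite tlift_tens.
Qed.

Lemma coalg_morphism_comp (C D E : coalgType k) (f : D -> E) (g : C -> D) :
  coalg_morphism f -> coalg_morphism g -> coalg_morphism (fun c => f (g c)).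
Proof.
move=> cf cg; case: (cf) (cg) => lf ef df [lg eg dg]; split=> [|c|c].
- lin.
- by rewrite ef eg.
- by rewrite df sweedler_morph //; lin.
Qed.

Lemma coalg_morphism_id (C : coalgType k) : coalg_morphism (fun c : C => c).
Proof. by split=> // c; rewrite tlift_eta. Qed.

End CoalgMorphism.

(** * Tensor products of coalgebras and coalgebra maps on them *)

Section TensorCoalgebra.
Variables (k : fieldType) (C D : coalgType k).

Definition tensor_comul_pure (c : C) (d : D) :=
  sweedler (fun c1 c2 => sweedler (fun d1 d2 =>
    tens (tens c1 d1) (tens c2 d2)) d) c.

Definition tensor_comul : tensor C D -> tensor (tensor C D) (tensor C D) :=
  tlift tensor_comul_pure.

Definition tensor_counit : tensor C D -> k^o :=
  tlift (fun c d => (counit c : k) *: counit d).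

Lemma tensor_comul_pure_bilin : bilin tensor_comul_pure.
Proof. by rewrite /tensor_comul_pure; lin. Qed.

Lemma tensor_comul_linear : linear tensor_comul.
Proof. exact: tlift_linear tensor_comul_pure_bilin. Qed.

Lemma tensor_counit_bilin :
  bilin (fun (c : C) (d : D) => (counit c : k) *: counit d).
Proof. by lin. Qed.

Lemma tensor_counit_linear : linear tensor_counit.
Proof. exact: tlift_linear tensor_counit_bilin. Qed.

Lemma tlift_tensor_comul (X : lmodType k)
    (b : tensor C D -> tensor C D -> X) c d : bilin b ->
  tlift b (tensor_comul (tens c d)) =
  sweedler (fun c1 c2 => sweedler (fun d1 d2 =>
    b (tens c1 d1) (tens c2 d2)) d) c.
Proof.
move=> bb; rewrite /tensor_comul tlift_tens; last first.
  exact: tensor_comul_pure_bilin.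
rewrite /tensor_comul_pure tlift_tlift //; apply: eq_tlift => c1 c2.
by rewrite tlift_tlift //; apply: eq_tlift => d1 d2; rewrite tlift_tens.
Qed.

Lemma tensor_counit_tens c d :
  tensor_counit (tens c d) = (counit c : k) *: counit d.
Proof. exact: (tlift_tens _ _ tensor_counit_bilin). Qed.

Lemma tensor_counit_scale (X : lmodType k) c d (x : X) :
  (tensor_counit (tens c d) : k) *: x =
  (counit d : k) *: ((counit c : k) *: x).
Proof. by rewrite tensor_counit_tens scalerA mulrC. Qed.

Lemma tensor_comulA (t : tensor C D) :
  tlift (fun x z => tlift (fun x1 x2 => tens (tens x1 x2) z) (tensor_comul x))
    (tensor_comul t)
  = tlift (fun x y => tlift (fun y1 y2 => tens (tens x y1) y2) (tensor_comul y))
      (tensor_comul t).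
Proof.
have lc := tensor_comul_linear.
move: t; apply: tens_ext => [||c d]; [by lin|by lin|].
rewrite !tlift_tensor_comul; [|by lin..].
(* The exchange brings both splittings of [c] outside those of [d], so that coassociativity can be
   used first in [C] and then in [D]. *)
under eq_tlift => x z do (under eq_tlift => x' z' do
  (rewrite tlift_tensor_comul; last by lin); rewrite exchange_tlift).
under [RHS]eq_tlift => x z do (under eq_tlift => x' z' do
  (rewrite tlift_tensor_comul; last by lin); rewrite exchange_tlift).
rewrite sweedlerA; [|by lin..].
apply: eq_tlift => x y; apply: eq_tlift => y1 y2.
by rewrite sweedlerA; [|by lin..].
Qed.

Lemma tensor_counitl (t : tensor C D) :
  tlift (fun x y => (tensor_counit x : k) *: y) (tensor_comul t) = t.
Proof.
have lc := tensor_comul_linear; have le := tensor_counit_linear.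
move: t; apply: tens_ext => [||c d]; [by lin|by lin|].
rewrite tlift_tensor_comul; last by lin.
(* The counit of [D] contracts the inner sum; that of [C] then contracts the outer one. *)
transitivity (sweedler (fun c1 c2 => (counit c1 : k) *: tens c2 d) c).
  apply: eq_tlift => c1 c2; rewrite -tensZl.
  rewrite -[RHS](sweedler_counitl (f := tens ((counit c1 : k) *: c2))).
    by apply: eq_tlift => d1 d2; rewrite tensor_counit_scale -tensZl.
  by lin.
by rewrite (sweedler_counitl (f := fun c => tens c d)); last by lin.
Qed.

Lemma tensor_counitr (t : tensor C D) :
  tlift (fun x y => (tensor_counit y : k) *: x) (tensor_comul t) = t.
Proof.
have lc := tensor_comul_linear; have le := tensor_counit_linear.
move: t; apply: tens_ext => [||c d]; [by lin|by lin|].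
rewrite tlift_tensor_comul; last by lin.
transitivity (sweedler (fun c2 c1 => (counit c1 : k) *: tens c2 d) c).
  apply: eq_tlift => c2 c1; rewrite -tensZl.
  rewrite -[RHS](sweedler_counitr (f := tens ((counit c1 : k) *: c2))).
    by apply: eq_tlift => d2 d1; rewrite tensor_counit_scale -tensZl.
  by lin.
by rewrite (sweedler_counitr (f := fun c => tens c d)); last by lin.
Qed.

HB.instance Definition _ := isCoalgebra.Build k (tensor C D)
  tensor_comul_linear tensor_counit_linear tensor_comulA tensor_counitl
  tensor_counitr.

Lemma sweedler_tens (X : lmodType k) (b : tensor C D -> tensor C D -> X) c d :
  bilin b ->
  sweedler b (tens c d) =
  sweedler (fun c1 c2 => sweedler (fun d1 d2 =>
    b (tens c1 d1) (tens c2 d2)) d) c.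
Proof. exact: tlift_tensor_comul. Qed.

Lemma counit_tens c d :
  counit (tens c d : tensor C D) = (counit c : k) *: counit d.
Proof. exact: tensor_counit_tens. Qed.

End TensorCoalgebra.

Lemma coalg_morphism_tens (k : fieldType) (C D C' D' : coalgType k)
    (f : C -> C') (g : D -> D') :
  coalg_morphism f -> coalg_morphism g ->
  coalg_morphism (tlift (fun c d => tens (f c) (g d)) :
    tensor C D -> tensor C' D').
Proof.
move=> cf cg; case: (cf) (cg) => lf ef df [lg eg dg].
have bfg : bilin (fun c d => tens (f c) (g d)) by lin.
split; first by lin.
  apply: (tens_ext (X := k^o)) => [||c d]; [by lin|by lin|].
  by rewrite tlift_tens // !counit_tens ef eg.
apply: tens_ext => [||c d]; [by lin|by lin|].
rewrite sweedler_tens; last by lin.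
rewrite tlift_tens // -[LHS]tlift_eta sweedler_tens; last by lin.
rewrite (sweedler_morph _ cf); last by lin.
apply: eq_tlift => c1 c2; rewrite (sweedler_morph _ cg); last by lin.
by apply: eq_tlift => d1 d2; rewrite !tlift_tens.
Qed.

(** The axioms [comulM] and [counitM], read on the tensor coalgebra. *)
Lemma coalg_morphism_mul (k : fieldType) (B : bialgType k) :
  coalg_morphism (tlift (fun x y => x * y) : tensor B B -> B).
Proof.
have bm : bilin (fun x y : B => x * y) by lin.
split; first by lin.
  apply: (tens_ext (X := k^o)) => [||c d]; [by lin|by lin|].
  by rewrite tlift_tens // counit_tens counitM.
apply: tens_ext => [||c d]; [by lin|by lin|].
rewrite sweedler_tens; last by lin.
rewrite tlift_tens // comulM.
apply: eq_tlift => c1 c2; apply: eq_tlift => d1 d2.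
by rewrite !tlift_tens.
Qed.

(** Universal properties compare maps, not elements; this encodes a grouplike element as a coalgebra
    map, so that [phi 1] can be compared with [1]. *)
Lemma coalg_morphism_grouplike (k : fieldType) (C D : coalgType k) (g : D) :
  counit g = 1 -> comul g = tens g g ->
  coalg_morphism (fun c : C => (counit c : k) *: g).
Proof.
move=> eg dg; split=> [|c|c]; first by lin.
  by rewrite (linZ _ _ counit_linear) eg; apply: mulr1.
rewrite (linZ _ _ comul_linear) dg.
under eq_tlift => x y do rewrite tensZl tensZr.
rewrite (sweedler_counitl (f := fun c => (counit c : k) *: tens g g)) //.
by lin.
Qed.

(** * Spaces of linear maps and convolution algebras *)

Section LinearMaps.
Variables (k : fieldType) (U W : lmodType k).

(** Linearity is stored as a boolean, so that maps equal pointwise are equal. The spaces may be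
    infinite-dimensional, which rules out ['Hom(U, W)]. *)
Definition lhom := {f : U -> W | `[< linear f >]}.
HB.instance Definition _ := Choice.on lhom.

Definition lapp (f : lhom) : U -> W := sval f.
Definition mklhom (f : U -> W) (lf : linear f) : lhom :=
  exist _ f (asboolT lf).

Lemma lapp_linear (f : lhom) : linear (lapp f).
Proof. exact/asboolP/(valP f). Qed.

Lemma lappE f (lf : linear f) : lapp (mklhom lf) = f.
Proof. by []. Qed.

Lemma lhomP (f g : lhom) : lapp f =1 lapp g -> f = g.
Proof. by move=> fg; apply: val_inj; apply/funext. Qed.

Fact lhom0_linear : linear (fun _ : U => 0 : W).
Proof. by move=> a x y; rewrite scaler0 addr0. Qed.

Fact lhomN_linear (f : lhom) : linear (fun x => - lapp f x).
Proof. by move=> a x y; rewrite lapp_linear opprD scalerN. Qed.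

Fact lhomD_linear (f g : lhom) : linear (fun x => lapp f x + lapp g x).
Proof. by move=> a x y; rewrite !lapp_linear scalerDr addrACA. Qed.

Fact lhomZ_linear a (f : lhom) : linear (fun x => a *: lapp f x).
Proof. by apply: lin_scaler; apply: lapp_linear. Qed.

Definition lhom0 := mklhom lhom0_linear.
Definition lhomN f := mklhom (lhomN_linear f).
Definition lhomD f g := mklhom (lhomD_linear f g).
Definition lhomZ a f := mklhom (lhomZ_linear a f).

Fact lhomDA : associative lhomD.
Proof. by move=> f g h; apply: lhomP => x; apply: addrA. Qed.
Fact lhomDC : commutative lhomD.
Proof. by move=> f g; apply: lhomP => x; apply: addrC. Qed.
Fact lhom0D : left_id lhom0 lhomD.
Proof. by move=> f; apply: lhomP => x; apply: add0r. Qed.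
Fact lhomND : left_inverse lhom0 lhomN lhomD.
Proof. by move=> f; apply: lhomP => x; apply: addNr. Qed.

HB.instance Definition _ :=
  GRing.isZmodule.Build lhom lhomDA lhomDC lhom0D lhomND.

Fact lhomZA a b f : lhomZ a (lhomZ b f) = lhomZ (a * b) f.
Proof. by apply: lhomP => x; apply: scalerA. Qed.
Fact lhom1Z : left_id 1 lhomZ.
Proof. by move=> f; apply: lhomP => x; apply: scale1r. Qed.
Fact lhomZDr : right_distributive lhomZ +%R.
Proof. by move=> a f g; apply: lhomP => x; apply: scalerDr. Qed.
Fact lhomZDl f : {morph lhomZ^~ f : a b / a + b}.
Proof. by move=> a b; apply: lhomP => x; apply: scalerDl. Qed.

HB.instance Definition _ :=
  GRing.Zmodule_isLmodule.Build k lhom lhomZA lhom1Z lhomZDr lhomZDl.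

End LinearMaps.

(* The unit of the convolution algebra differs from [0] only when [C] does not
   vanish, whence the element of counit [1]. *)
Section Convolution.
Variables (k : fieldType) (C : coalgType k) (B : algType k) (c0 : C).
Hypothesis counit_c0 : counit c0 = 1.

(** The proof is a phantom argument of the type, from which the ring instance recovers [1 != 0]. *)
Definition conv (_ : counit c0 = 1) : Type := lhom C B.
Local Notation convC := (conv counit_c0).

HB.instance Definition _ := GRing.Lmodule.on convC.
Implicit Types f g h : convC.

Fact conv_mul_linear f g :
  linear (fun c => sweedler (fun x y => lapp f x * lapp g y) c).
Proof. by have lf := lapp_linear f; have lg := lapp_linear g; lin. Qed.

Fact conv_one_linear : linear (fun c : C => (counit c : k) *: (1 : B)).
Proof. by lin. Qed.

Definition conv_mul f g : convC := mklhom (conv_mul_linear f g).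
Definition conv_one : convC := mklhom conv_one_linear.

Fact conv_mulA : associative conv_mul.
Proof.
move=> f g h; apply: lhomP => c; rewrite !lappE.
have lf := lapp_linear f; have lg := lapp_linear g; have lh := lapp_linear h.
have ll (b : B) : linear ( *%R b) by exact/lin_mulr/lin_id.
have lr (b : B) : linear (fun x => x * b) by exact/lin_mull/lin_id.
under eq_tlift => x y do rewrite (lin_tliftE _ _ (ll _)).
under [RHS]eq_tlift => x y do rewrite (lin_tliftE _ _ (lr _)).
rewrite -sweedlerA; [|by lin..].
by apply: eq_tlift => x y; apply: eq_tlift => x1 x2; rewrite mulrA.
Qed.

Fact conv_mul1l : left_id conv_one conv_mul.
Proof.
move=> f; apply: lhomP => c; rewrite !lappE; have lf := lapp_linear f.
under eq_tlift => x y do rewrite -scalerAl mul1r.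
by rewrite (sweedler_counitl (f := lapp f)).
Qed.

Fact conv_mul1r : right_id conv_one conv_mul.
Proof.
move=> f; apply: lhomP => c; rewrite !lappE; have lf := lapp_linear f.
under eq_tlift => x y do rewrite -scalerAr mulr1.
by rewrite (sweedler_counitr (f := lapp f)).
Qed.

Let conv_mul_bilin : bilin conv_mul.
Proof.
split=> [g a f f'|f a g g']; apply: lhomP => c.
- rewrite -[RHS]/(a *: sweedler _ c + sweedler _ c) -tlift_combine.
  by apply: eq_tlift => x y; rewrite scalerAl -mulrDl.
- rewrite -[RHS]/(a *: sweedler _ c + sweedler _ c) -tlift_combine.
  by apply: eq_tlift => x y; rewrite scalerAr -mulrDr.
Qed.

Fact conv_mulDl : left_distributive conv_mul +%R.
Proof. by move=> f f' g; rewrite (linD (bilinl conv_mul_bilin g)). Qed.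

Fact conv_mulDr : right_distributive conv_mul +%R.
Proof. by move=> f g g'; rewrite (linD (bilinr conv_mul_bilin f)). Qed.

Fact conv_one_neq0 : conv_one != 0.
Proof.
apply/eqP => /(congr1 (fun f => lapp f c0)); rewrite lappE counit_c0 scale1r.
by apply/eqP/oner_neq0.
Qed.

HB.instance Definition _ := GRing.Zmodule_isNzRing.Build convC
  conv_mulA conv_mul1l conv_mul1r conv_mulDl conv_mulDr conv_one_neq0.

Fact conv_scaleAl a f g : a *: (f * g) = (a *: f) * g.
Proof.
by rewrite -[RHS]/(conv_mul _ _) (linZ _ _ (bilinl conv_mul_bilin g)).
Qed.

Fact conv_scaleAr a f g : a *: (f * g) = f * (a *: g).
Proof.
by rewrite -[RHS]/(conv_mul _ _) (linZ _ _ (bilinr conv_mul_bilin f)).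
Qed.

HB.instance Definition _ := GRing.Lmodule_isLalgebra.Build k convC conv_scaleAl.
HB.instance Definition _ := GRing.Lalgebra_isAlgebra.Build k convC conv_scaleAr.

End Convolution.

(** * Measuring maps out of tensor algebras *)

Section Measuring.
Variable k : fieldType.

Lemma measuring_comp (C D : coalgType k) (A B : algType k) (s : D -> A -> B)
    (f : C -> D) :
  measuring s -> coalg_morphism f -> measuring (fun c => s (f c)).
Proof.
move=> [bs ms us] cf; case: (cf) => lf ef _; split=> [|c a a'|c].
- by lin.
- by rewrite ms sweedler_morph //; lin.
- by rewrite us ef.
Qed.

Variables (V : lmodType k) (T : algType k) (i : V -> T).
Hypothesis tensorT : is_tensor_algebra i.

Section Fixed.
Variables (C : coalgType k) (c0 : C) (counit_c0 : counit c0 = 1).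
Variable B : algType k.

(* A measuring map [C -> Hom(T, B)] is an algebra morphism from [T] to the
   convolution algebra [Hom(C, B)]. *)
Lemma measuring_conv (s : C -> T -> B) (bs : bilin s) : measuring s ->
  alg_morphism (fun a => mklhom (bilinl bs a) : conv B counit_c0).
Proof.
move=> [_ sM s1]; split=> [a x y|].
  by apply: lhomP => c; apply: (bilinr bs c).
by split=> [|x y]; apply: lhomP => c; [apply: s1|apply: sM].
Qed.

(** By [measuring_conv] both maps are algebra morphisms to the convolution algebra that extend the
    same linear map on [V]. *)
Lemma measuring_tensor_ext (s s' : C -> T -> B) :
  measuring s -> measuring s' -> (forall c v, s c (i v) = s' c (i v)) ->
  forall c a, s c a = s' c a.
Proof.
move=> ms ms' ss' c a; case: (ms) (ms') => bs _ _ [bs' _ _].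
have am := measuring_conv bs ms; have am' := measuring_conv bs' ms'.
have ls : linear (fun v => mklhom (bilinl bs (i v)) : conv B counit_c0).
  by move=> b x y; rewrite tensorT.1 am.1.
have [g [_ ug]] := tensorT.2 _ _ ls.
have e := ug _ (conj am (fun _ => erefl)).
have e' := ug _ (conj am' _).
have := congr1 (fun f => lapp (f a) c) (etrans (esym e) (e' _)).
by apply=> v; apply: lhomP => d; rewrite !lappE.
Qed.

(** The algebra morphism to the convolution algebra that extends [s] is the required map: its
    multiplicativity and unit law are the measuring axioms. *)
Lemma measuring_tensor_lift (s : C -> V -> B) : bilin s ->
  exists2 t : C -> T -> B, measuring t & forall c v, t c (i v) = s c v.
Proof.
move=> bs; have ls : linear (fun v => mklhom (bilinl bs v) : conv B counit_c0).
  by move=> a x y; apply: lhomP => c; apply: (bilinr bs c).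
have [g [[[lg [g1 gM]] gi] _]] := tensorT.2 _ _ ls.
exists (fun c a => lapp (g a) c) => [|c v]; last by rewrite gi.
split=> [|c a a'|c]; last 2 first.
- by rewrite gM.
- by rewrite g1.
split=> [a|c b x y]; first exact: lapp_linear.
by rewrite lg.
Qed.

(** The measuring maps pulled back along [f] and [g] agree on generators, hence everywhere, so [f]
    and [g] factor the same measuring map. The inverse laws, the compatibility of [phi] with unit
    and product, and uniqueness all come from this. *)
Lemma universal_tensor_ext (P : coalgType k) (pi : P -> T -> B)
    (f g : C -> P) :
  universal_measuring pi -> coalg_morphism f -> coalg_morphism g ->
  (forall c v, pi (f c) (i v) = pi (g c) (i v)) -> f =1 g.
Proof.
move=> [mpi upi] cf cg fg c.
have [h [_ uh]] := upi C _ (measuring_comp mpi cf).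
rewrite -(uh _ (conj cf (fun _ _ => erefl))) -(uh _ (conj cg _)) //.
exact: measuring_tensor_ext (measuring_comp mpi cf) (measuring_comp mpi cg) fg.
Qed.

End Fixed.
End Measuring.

(** * Linear retractions, subcoalgebras and factoring through injections *)

Lemma linear_left_inverse (k : fieldType) (U W : lmodType k) (j : U -> W) :
  linear j -> injective j -> exists2 r : W -> U, linear r & cancel j r.
Proof.
move=> lj injj.
(* A maximal [N] is a complement of the image of [j], and [r] projects along it. The empty set
   satisfies [disj], as the empty chain requires; maximality then forces [0] into [N]. *)
pose disj (N : W -> Prop) := (forall a x y, N x -> N y -> N (a *: x + y)) /\
  (forall u, N (j u) -> u = 0).
have [F Fdisj Ftot|N [[Nlin Nj] Nmax]] := @classical_sets.Zorn_bigcup W disj.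
  split=> [a x y [X FX Xx] [Y FY Yy]|u [X FX Xju]]; last first.
    by case: (Fdisj X FX) => _; apply.
  have [XY|YX] := Ftot _ _ FX FY.
  - by exists Y => //; case: (Fdisj Y FY) => clY _; apply: clY => //; apply: XY.
  - by exists X => //; case: (Fdisj X FX) => clX _; apply: clX => //; apply: YX.
have N0 : N 0.
  apply: contrapT => nN0; apply: (Nmax (fun x => x = 0)).
    split=> [x Nx|]; last by move=> /(_ 0 erefl).
    by case: nN0; rewrite -[0](addNr x) -scaleN1r; apply: Nlin.
  split=> [a x y -> ->|u]; first by rewrite scaler0 addr0.
  by rewrite -(lin0 lj); apply: injj.
have NZ (a : k) x : N x -> N (a *: x).
  by move=> Nx; rewrite -[_ *: _]addr0; apply: Nlin.
have NjD w : exists u, N (w - j u).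
  (* Otherwise the span of [N] and [w] is strictly larger and still satisfies [disj]: from
     [j u = a *: w + y] with [a] nonzero, [w - j (a^-1 *: u)] would lie in [N]. *)
  apply: contrapT => nw.
  apply: (Nmax (fun x => exists a y, N y /\ x = a *: w + y)).
    split=> [y Ny|]; first by exists 0, y; rewrite scale0r add0r.
    move=> sN; apply: nw; exists 0; rewrite (lin0 lj) subr0; apply: sN.
    by exists 1, 0; rewrite scale1r addr0.
  split=> [a _ _ [b [y [Ny ->]]] [c [z [Nz ->]]]|u [a [y [Ny e]]]].
    exists (a * b + c), (a *: y + z); split; first exact: Nlin.
    by rewrite scalerDr addrACA scalerDl scalerA.
  have [a0|an0] := eqVneq a 0.
    by apply: Nj; rewrite e a0 scale0r add0r.
  case: nw; exists (a^-1 *: u); rewrite (linZ _ _ lj) e scalerDr scalerA.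
  by rewrite mulVf // scale1r opprD addNKr -scaleN1r; exact: NZ (NZ _ _ Ny).
pose r w := sval (cid (NjD w)); have Nr w : N (w - j (r w)).
  exact: svalP (cid (NjD w)).
(* As [r w] is the only such [u], linearity of [r] and [cancel j r] both follow. *)
have rP w u : N (w - j u) -> r w = u.
  move=> Nu; apply/subr0_eq/Nj; rewrite (linD lj) -scaleN1r (linZ _ _ lj).
  have := Nlin (- 1) _ _ (Nr w) Nu.
  by rewrite !scaleN1r opprB addrA subrK.
exists r => [a x y|u]; last by apply: rP; rewrite subrr.
by apply: rP; rewrite lj opprD addrACA -scalerBr; apply: Nlin.
Qed.

(** A retraction [r] of [j] that is merely linear is enough: apply [r (x) r] to the comultiplication
    of [j (f c)], computed once through [j] and once through the composite. *)
Lemma coalg_morphism_cancel (k : fieldType) (C D E : coalgType k) (j : D -> E)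
    (f : C -> D) :
  coalg_morphism j -> injective j -> coalg_morphism (fun c => j (f c)) ->
  coalg_morphism f.
Proof.
move=> cj injj [ljf ejf djf]; case: (cj) => lj ej _.
have [r lr jK] := linear_left_inverse lj injj.
split=> [a x y|c|c]; first by apply: injj; rewrite ljf lj.
  by rewrite -ej.
have b : bilin (fun x y => tens (r x) (r y)) by lin.
transitivity (sweedler (fun x y => tens (r x) (r y)) (j (f c))).
  rewrite (sweedler_morph _ cj) // -[LHS]tlift_eta.
  by apply: eq_tlift => x y; rewrite !jK.
rewrite djf tlift_tlift //.
by apply: eq_tlift => x y; rewrite tlift_tens // !jK.
Qed.

(** Allows the maximality in [is_PV] to be applied to the range of a coalgebra map. *)
Lemma subcoalgebra_image (k : fieldType) (C D : coalgType k) (f : C -> D) :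
  coalg_morphism f -> subcoalgebra (fun d => `[< exists c, f c = d >]).
Proof.
move=> [lf _ df]; split.
  split; first by apply/asboolP; exists 0; apply: lin0.
  move=> a _ _ /asboolP[x <-] /asboolP[y <-].
  by apply/asboolP; exists (a *: x + y); apply: lf.
move=> _ /asboolP[c <-]; exists [seq (f p.1, f p.2) | p <- repr (comul c)].
split; last by rewrite df big_map.
by move=> _ /mapP[p _ ->]; split; apply/asboolP; [exists p.1|exists p.2].
Qed.

(** * Endomorphisms of [V] obtained from generators *)

Section Generators.
Variables (k : fieldType) (V : vectType k).

Lemma dualv_sep (v w : V) : (forall f : 'Hom(V, k^o), f v = f w) -> v = w.
Proof.
move=> vw; rewrite -[v]dual_basisl -[w]dual_basisl.
by apply: eq_bigr => i _; rewrite vw.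
Qed.

Lemma trace_pairingP a (F G : 'End(V)) d :
  trace_pairing (a *: F + G) d = a *: trace_pairing F d + trace_pairing G d.
Proof.
rewrite /trace_pairing -tlift_combine; apply: eq_tlift => v f.
by rewrite add_lfunE scale_lfunE linearP.
Qed.

(** Surjectivity of the trace pairing provides each [G x]; injectivity makes the choice linear in
    [x]. *)
Lemma ex_trace_pairing (X : lmodType k) (s : X -> coEnd V -> k^o) : bilin s ->
  exists2 G : X -> 'End(V), linear G & forall x, trace_pairing (G x) =1 s x.
Proof.
move=> bs; have ex x := cid (trace_pairing_surj (bilinr bs x)).
exists (fun x => sval (ex x)) => [a x y|x]; last exact: svalP (ex x).
apply: trace_pairing_inj => d; rewrite trace_pairingP !(svalP (ex _)).
exact: (bilinl bs d).
Qed.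

Variables (T : algType k) (i : V -> T).
Hypothesis tensorT : is_tensor_algebra i.

(** Every functional on [V] extends to an algebra morphism from [T] to [k], and functionals separate
    the points of [V]. *)
Lemma tensor_algebra_inj : injective i.
Proof.
move=> v w ivw; apply: dualv_sep => f.
have [g [[_ gi] _]] := tensorT.2 k^o f (@linearP _ _ _ _ f).
by rewrite -!gi ivw.
Qed.

(** Injectivity of [i] makes the chosen preimages unique, hence linear in both arguments. *)
Lemma ex_End_action (X : lmodType k) (pi : X -> T -> T) : bilin pi ->
  (forall x v, exists w, pi x (i v) = i w) ->
  exists2 F : X -> 'End(V), linear F & forall x v, i (F x v) = pi x (i v).
Proof.
move=> bpi piV; have li := tensorT.1; have inji := tensor_algebra_inj.
pose m x v := sval (cid (piV x v)).
have mP x v : i (m x v) = pi x (i v) by rewrite (svalP (cid (piV x v))).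
have lm x : linear (m x).
  move=> a u v; apply: inji; rewrite li !mP li; exact: (bilinr bpi x).
pose F x : 'End(V) := linfun (HB.pack_for {linear V -> V} (m x)
  (GRing.isLinear.Build k V V *:%R (m x) (lm x))).
have FP x v : i (F x v) = pi x (i v) by rewrite lfunE mP.
exists F => // a x y; apply/lfunP => v; apply: inji.
rewrite FP add_lfunE scale_lfunE li !FP; exact: (bilinl bpi).
Qed.

End Generators.

(** * The isomorphism between [P(V)] and the finite dual *)

Theorem theorem3p3 (R : realType) (k : fieldType) (hk : real_or_complex R k)
    (V : vectType k)
    (* [TV] and [P(TV, TV)] *)
    (TV : algType k) (i : V -> TV) (hTV : is_tensor_algebra i)
    (P : bialgType k) (pi : P -> TV -> TV) (hP : is_measuring_bialgebra pi)
    (* [P(V)] *)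
    (PV : bialgType k) (j : PV -> P) (hPV : is_PV i pi j)
    (* [T D] for [D := coEnd V], and its finite dual *)
    (TD : bialgType k) (iD : coEnd V -> TD) (hTD : is_tensor_bialgebra iD)
    (Q : bialgType k) (piQ : Q -> TD -> k^o) (hQ : is_finite_dual piQ) :
  (* the isomorphism pairs [p] with [v (x) f] as [f (pi p v)] *)
  exists! phi : PV -> Q,
    bialg_isomorphism phi /\
    forall (p : PV) (v w : V) (f : 'Hom(V, k^o)),
      pi (j p) (i v) = i w -> piQ (phi p) (iD (tens v f)) = f w.
Proof.
have inji := tensor_algebra_inj hTV; have li := hTV.1.
have [uP piM pi1] := hP; have bpi : bilin pi by case: uP => -[].
have [[[lj [j1 jM]] cj] injj [S [SP _ Sgen Smax]]] := hPV.
have [TD_tens ciD] := hTD; have liD := TD_tens.1.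
have [uQ piQM piQ1] := hQ; have bpiQ : bilin piQ by case: uQ => -[].
(* The units of [PV] and [Q], and [tens 1 1], serve as the elements of counit [1] required by the
   convolution algebras. *)
have c1 (B : bialgType k) : counit (1 : B) = 1 := counit1.
have cPV2 : counit (tens 1 1 : tensor PV PV) = 1.
  by rewrite counit_tens !c1 scale1r.
(* [F] and [G] record how elements of [PV] and [Q] act on generators, both as linear maps to
   [End(V)]. *)
have [F lF FP] : exists2 F : PV -> 'End(V), linear F &
    forall p v, i (F p v) = pi (j p) (i v).
  apply: (ex_End_action hTV (pi := fun p => pi (j p))) => [|p v]; first by lin.
  by apply: Sgen; apply/SP; exists p.
have F1 : F 1 = \1%VF.
  by apply/lfunP => v; apply: inji; rewrite FP j1 pi1 id_lfunE.
have FM p q : F (p * q) = (F p \o F q)%VF.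
  by apply/lfunP => v; apply: inji; rewrite comp_lfunE !FP jM piM.
have [G lG GP] : exists2 G : Q -> 'End(V), linear G &
    forall q d, trace_pairing (G q) d = piQ q (iD d).
  by apply: (ex_trace_pairing (s := fun q d => piQ q (iD d))); lin.
(* [phi] classifies the measuring map on [TD] whose values on generators are
   [trace_pairing (F p)]. *)
have [|s ms sE] := measuring_tensor_lift TD_tens (c1 PV)
  (s := fun p d => trace_pairing (F p) d) _.
  split=> [d a p q|p]; last exact: trace_pairing_linear.
  by rewrite lF trace_pairingP.
have [phi [[cphi phiE] _]] := uQ.2 _ _ ms.
have phiP p d : piQ (phi p) (iD d) = trace_pairing (F p) d.
  by rewrite -phiE sE.
(* In the other direction, [G] yields a coalgebra map [rho] to [P], still to be lifted along [j]. *)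
have [|t mt tE] := measuring_tensor_lift hTV (c1 Q)
  (s := fun q v => i (G q v)) _.
  split=> [v a p q|q]; last by move=> a u v; rewrite linearP li.
  by rewrite lG add_lfunE scale_lfunE li.
have [rho [[crho rhoE] _]] := uP.2 _ _ mt.
have rhoP q v : pi (rho q) (i v) = i (G q v) by rewrite -rhoE tE.
(* The range of [rho] is a subcoalgebra preserving [V], since [rho q] acts there as [G q]; by
   maximality it lies in [S], the image of [j]. *)
have ex_psi q : exists p, j p = rho q.
  apply/SP/(Smax _ (subcoalgebra_image crho)); last by apply/asboolP; exists q.
  by move=> _ /asboolP[{}q <-] v; exists (G q v).
pose psi q := sval (cid (ex_psi q)).
have jpsi q : j (psi q) = rho q := svalP (cid (ex_psi q)).
have cpsi : coalg_morphism psi.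
  apply: (coalg_morphism_cancel cj injj).
  by rewrite (_ : (fun q => j (psi q)) = rho) //; apply/funext.
have psiK : cancel psi phi.
  apply: (universal_tensor_ext TD_tens (c1 Q) uQ)
    (coalg_morphism_comp cphi cpsi) (coalg_morphism_id Q) _ => q d.
  (* What remains is [F (psi q) = G q], checked in [TV] after applying [i]. *)
  rewrite phiP -GP; congr trace_pairing; apply/lfunP => v.
  by apply: inji; rewrite FP jpsi rhoP.
have phiK : cancel phi psi.
  (* After [j], the maps to compare go to the universal coalgebra [P]; on generators the identity is
     [G (phi p) = F p]. *)
  move=> p; apply: injj; rewrite jpsi.
  apply: (universal_tensor_ext hTV (c1 PV) uP)
    (coalg_morphism_comp crho cphi) cj _ p.
  move=> p v; rewrite rhoP -FP; suff -> : G (phi p) = F p by [].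
  by apply: trace_pairing_inj => d; rewrite GP phiP.
have phi1 : phi 1 = 1.
  (* Both [phi 1] and [1] are grouplike, and both pair with generators to the counit, since [F 1] is
     the identity. *)
  have cf := coalg_morphism_grouplike PV (c1 Q) comul1.
  have [lphi ephi dphi] := cphi.
  have e1 : counit (phi 1) = 1 by rewrite ephi.
  have d1 : comul (phi 1) = tens (phi 1) (phi 1).
    by rewrite dphi comul1 tlift_tens //; lin.
  have cg := coalg_morphism_grouplike PV e1 d1.
  suff /(_ 1) : (fun p : PV => (counit p : k) *: phi 1) =1
      (fun p => (counit p : k) *: 1) by rewrite c1 !scale1r.
  apply: (universal_tensor_ext TD_tens (c1 PV) uQ) cg cf _ => p d.
  rewrite !(linZ _ _ (bilinl bpiQ _)) phiP F1 trace_pairing_id piQ1.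
  by case: ciD => _ ->.
have phiM : {morph phi : p q / p * q}.
  move=> p q; have [lphi _ _] := cphi.
  have bmP : bilin (fun x y : PV => x * y) by lin.
  have bmQ : bilin (fun x y : Q => x * y) by lin.
  have bphi : bilin (fun p q => tens (phi p) (phi q)) by lin.
  have cf := coalg_morphism_comp cphi (coalg_morphism_mul PV).
  have cg := coalg_morphism_comp (coalg_morphism_mul Q)
    (coalg_morphism_tens cphi cphi).
  have mulE : (fun u => phi (tlift (fun x y => x * y) u)) =1
      (fun u => tlift (fun x y => x * y)
        (tlift (fun p q => tens (phi p) (phi q)) u)).
    apply: (universal_tensor_ext TD_tens cPV2 uQ) cf cg _ => u d; move: u.
    apply: (tens_ext (X := k^o)) => [||{}p {}q]; [by lin|by lin|].
    (* [FM] makes the product a composition, [trace_pairing_comp] makes that a convolution over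
       [coEnd V], and [ciD] carries it to [TD]. *)
    rewrite !tlift_tens // phiP FM trace_pairing_comp piQM.
    rewrite (sweedler_morph _ ciD); last by lin.
    by apply: eq_tlift => x y; rewrite !phiP.
  by have := mulE (tens p q); rewrite !tlift_tens.
exists phi; split.
  split; last first.
    move=> p v w f; rewrite phiP trace_pairing_tens -FP => /inji -> //.
  split; first by split=> //; split=> //; case: cphi.
  exists psi; split=> //; split=> //; split; first by case: cpsi.
  by split=> [|p q]; apply: (can_inj phiK); rewrite ?phiM !psiK ?phi1.
(* The pairing formula at [w := F p v] determines [phi'] on generators. *)
move=> phi' [[[_ cphi'] _] phi'P]; apply/funext.
apply: (universal_tensor_ext TD_tens (c1 PV) uQ) cphi cphi' _ => p.
apply: tens_ext => [||v f]; [by lin|by lin|].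
by rewrite phiP trace_pairing_tens (phi'P p v (F p v)).
Qed.
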